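(* The multiplication $\ell_1\times c_0\to\ell_1$, $(x,y)\mapsto xy$, is a uniformly open mapping. More exactly, for any $\varepsilon>0$ and any $x\in\ell_1$, $y\in c_0$, $$\mathrm{B}_1\left(xy,\frac{\varepsilon^2}{16}\right)\subseteq \mathrm{B}_1(x,\varepsilon)\cdot \left(\mathrm{B}_{\infty}(y,\varepsilon)\cap c_0\right).$$
   Context: $\ell_1$ and $\ell_\infty$ are the usual Banach spaces of real sequences indexed by $\mathbb{N}=\{1,2,\dots\}$ with norms $\|\cdot\|_1$ and $\|\cdot\|_\infty$, and $c_0$ is the space of real sequences converging to $0$ with the norm $\|\cdot\|_\infty$. The product $xy=(x_ny_n)_{n\in\mathbb{N}}$ is taken coordinatewise. $\mathrm{B}_1(x,r)$ and $\mathrm{B}_\infty(y,r)$ are the open balls in $\ell_1$ and $\ell_\infty$, and $A\cdot B=\{uv: u\in A,\ v\in B\}$. A mapping $F\colon Y\to Z$ between metric spaces is uniformly open if for every $\varepsilon>0$ there is $\delta>0$ such that $\mathrm{B}(F(y),\delta)\subseteq F[\mathrm{B}(y,\varepsilon)]$ for all $y\in Y$ ($\mathrm{B}(z,r)$ denotes the open ball). For the multiplication $\ell_1\times c_0\to\ell_1$ this means: for every $\varepsilon>0$ there is $\delta>0$ such that $\mathrm{B}_1(xy,\delta)\subseteq \mathrm{B}_1(x,\varepsilon)\cdot(\mathrm{B}_\infty(y,\varepsilon)\cap c_0)$ for all $(x,y)\in\ell_1\times c_0$. *)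

(* Defs.v *)
From HB Require Import structures.
From mathcomp Require Import all_boot all_order all_algebra.
From mathcomp Require Import all_classical all_reals all_analysis.

Set Implicit Arguments.
Unset Strict Implicit.
Unset Printing Implicit Defensive.

Import Order.TTheory GRing.Theory Num.Theory.
Import numFieldNormedType.Exports.

Local Open Scope classical_set_scope.
Local Open Scope ring_scope.

(* Sequences are indexed from 0; reindexing from 1 changes nothing. *)

Section ell1.
Context (R : realType).
Implicit Types x y : R^nat.

Definition ell1_pred : {pred R^nat} := [pred x : R^nat | `[< cvgn [normed series x] >]].

Record ell1 : Type := Ell1 { ell1_val :> nat -> R; _ : ell1_val \in ell1_pred }.

HB.instance Definition _ := [isSub for ell1_val].
HB.instance Definition _ := gen_eqMixin ell1.
HB.instance Definition _ := gen_choiceMixin ell1.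

Lemma ell1_predP x : reflect (cvgn [normed series x]) (x \in ell1_pred).
Proof. by rewrite inE; exact: asboolP. Qed.

Lemma ell1P (x : ell1) : cvgn [normed series x].
Proof. exact/ell1_predP/(valP x). Qed.
Arguments ell1P : clear implicits.

Lemma ell1_le x y : (forall n, `|x n| <= `|y n|) -> y \in ell1_pred ->
  x \in ell1_pred.
Proof.
move=> xy /ell1_predP cy; apply/ell1_predP.
by apply: series_le_cvg cy => // n; exact: normr_ge0.
Qed.

Lemma ell1_submod_closed : submod_closed ell1_pred.
Proof.
split=> [|a x y /ell1_predP cx /ell1_predP cy]; apply/ell1_predP.
  rewrite (_ : [normed series _] = cst 0); first exact: is_cvg_cst.
  by apply/funext => n; rewrite /= /series/= big1// => i _; rewrite normr0.
apply: (@series_le_cvg _ _ (`|a| *: (Num.norm \o x) + (Num.norm \o y))).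
- by move=> n; exact: normr_ge0.
- by move=> n; apply: addr_ge0; [apply: mulr_ge0|]; exact: normr_ge0.
- by move=> n; apply: (le_trans (ler_normD _ _)); rewrite lerD2r [leLHS]normrM.
- by apply: is_cvg_seriesD => //; exact: is_cvg_seriesZ.
Qed.

HB.instance Definition _ :=
  GRing.isSubmodClosed.Build R R^nat ell1_pred ell1_submod_closed.
HB.instance Definition _ := [SubChoice_isSubLmodule of ell1 by <:].

Definition ell1_norm (x : ell1) : R := limn [normed series x].

Lemma ell1_normD (x y : ell1) :
  ell1_norm (x + y) <= ell1_norm x + ell1_norm y.
Proof.
have [cx cy] := (ell1P x, ell1P y).
rewrite /ell1_norm -lim_seriesD//.
apply: lim_series_le; [exact: ell1P|exact: is_cvg_seriesD|].
by move=> n /=; exact: ler_normD.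
Qed.

Lemma ell1_normZ (a : R) (x : ell1) :
  ell1_norm (a *: x) = `|a| * ell1_norm x.
Proof.
have cx := ell1P x.
rewrite /ell1_norm -[RHS]/(`|a| *: _) -lim_seriesZ//.
congr (limn _); apply/funext => n; rewrite /= /series/=; apply: eq_bigr => i _.
exact: normrM.
Qed.

Lemma ell1_norm_coord (x : ell1) n : `|x n| <= ell1_norm x.
Proof.
have nd : nondecreasing_seq [normed series x].
  by apply: nondecreasing_series => i _ _; exact: normr_ge0.
apply: le_trans (nondecreasing_cvgn_le nd (ell1P x) n.+1).
by rewrite /= /series/= big_nat_recr//= lerDr sumr_ge0.
Qed.

Lemma ell1_norm_eq0 (x : ell1) : ell1_norm x = 0 -> x = 0.
Proof.
move=> x0; apply/val_inj/funext => n; apply/eqP.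
by rewrite -normr_le0 -x0; exact: ell1_norm_coord.
Qed.

HB.instance Definition _ :=
  Lmodule_isNormed.Build R ell1 ell1_normD ell1_normZ ell1_norm_eq0.

End ell1.

Section ellinf.
Context (R : realType).
Implicit Types x y : R^nat.

Definition ellinf_pred : {pred R^nat} := [pred x : R^nat | `[< bounded_fun x >]].

Record ellinf : Type :=
  Ellinf { ellinf_val :> nat -> R; _ : ellinf_val \in ellinf_pred }.

HB.instance Definition _ := [isSub for ellinf_val].
HB.instance Definition _ := gen_eqMixin ellinf.
HB.instance Definition _ := gen_choiceMixin ellinf.

Lemma ellinf_predP x :
  reflect (exists M, forall n, `|x n| <= M) (x \in ellinf_pred).
Proof.
rewrite inE; apply: (iffP (asboolP _)) => [/pinfty_ex_gt0[M _ xM]|[M xM]].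
  by exists M => n; exact: xM.
exists M; split=> [|N /ltW MN n _ /=]; first exact: num_real.
exact: le_trans MN.
Qed.

Lemma ellinf_submod_closed : submod_closed ellinf_pred.
Proof.
split=> [|a x y /ellinf_predP[M xM] /ellinf_predP[N yN]]; apply/ellinf_predP.
  by exists 0 => n; rewrite normr0.
exists (`|a| * M + N) => n.
by rewrite (le_trans (ler_normD _ _))// lerD// normrM ler_wpM2l.
Qed.

HB.instance Definition _ :=
  GRing.isSubmodClosed.Build R R^nat ellinf_pred ellinf_submod_closed.
HB.instance Definition _ := [SubChoice_isSubLmodule of ellinf by <:].

Definition ellinf_norm (x : ellinf) : R := sup (range (fun n => `|x n|)).

Lemma ellinf_has_sup (x : ellinf) : has_sup (range (fun n => `|x n|)).
Proof.
have /ellinf_predP[M xM] := valP x.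
by split; [exists `|x 0%N|, 0%N|exists M => _ [n _ <-]; exact: xM].
Qed.

Lemma ellinf_norm_coord (x : ellinf) n : `|x n| <= ellinf_norm x.
Proof. by apply: (sup_upper_bound (ellinf_has_sup x)); exists n. Qed.

Lemma ellinf_norm_le (x : ellinf) M :
  (forall n, `|x n| <= M) -> ellinf_norm x <= M.
Proof.
move=> xM; apply: ge_sup => [|_ [n _ <-]]; last exact: xM.
by case: (ellinf_has_sup x).
Qed.

Lemma ellinf_normD (x y : ellinf) :
  ellinf_norm (x + y) <= ellinf_norm x + ellinf_norm y.
Proof.
apply: ellinf_norm_le => n; apply: (le_trans (ler_normD _ _)).
by apply: lerD; exact: ellinf_norm_coord.
Qed.

Let ellinf_normZ_le (a : R) (x : ellinf) :
  ellinf_norm (a *: x) <= `|a| * ellinf_norm x.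
Proof.
apply: ellinf_norm_le => n; rewrite [leLHS]normrM ler_wpM2l//.
exact: ellinf_norm_coord.
Qed.

Lemma ellinf_normZ (a : R) (x : ellinf) :
  ellinf_norm (a *: x) = `|a| * ellinf_norm x.
Proof.
apply/eqP; rewrite eq_le ellinf_normZ_le/=.
have [->|a0] := eqVneq a 0.
  by rewrite normr0 mul0r (le_trans _ (ellinf_norm_coord _ 0%N)).
rewrite -ler_pdivlMl ?normr_gt0//.
by rewrite -{1}(scale1r x) -(mulVf a0) -scalerA -normfV ellinf_normZ_le.
Qed.

Lemma ellinf_norm_eq0 (x : ellinf) : ellinf_norm x = 0 -> x = 0.
Proof.
move=> x0; apply/val_inj/funext => n; apply/eqP.
by rewrite -normr_le0 -x0; exact: ellinf_norm_coord.
Qed.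

HB.instance Definition _ :=
  Lmodule_isNormed.Build R ellinf ellinf_normD ellinf_normZ ellinf_norm_eq0.

Lemma cvg0_ellinf x : x @ \oo --> (0 : R) -> x \in ellinf_pred.
Proof. by move=> /cvgP/cvg_seq_bounded bx; rewrite inE. Qed.

(* By cvg0_ellinf, these are all the null sequences. *)
Definition c0 : set ellinf := [set y : ellinf | y @ \oo --> (0 : R)].

End ellinf.
Arguments c0 : clear implicits.

Section mul.
Context (R : realType).

Lemma ell1_mul_subproof (x : ell1 R) (y : ellinf R) :
  (fun n => x n * y n) \in @ell1_pred R.
Proof.
apply: (@ell1_le _ _ (ellinf_norm y *: (x : R^nat))).
  move=> n; rewrite [leRHS]normrM normrM mulrC ler_wpM2r//.
  exact: le_trans (ellinf_norm_coord y n) (ler_norm _).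
by rewrite rpredZ// (valP x).
Qed.

Definition ell1_mul (x : ell1 R) (y : ellinf R) : ell1 R :=
  Ell1 (ell1_mul_subproof x y).

End mul.

(* Uniform openness of the restriction of F to the metric subspace D of Y:
   the open balls of D are the traces D `&` ball y e. *)
Definition uniformly_open_on (R : numFieldType) (Y Z : pseudoMetricType R)
    (D : set Y) (F : Y -> Z) : Prop :=
  forall e : R, 0 < e -> exists2 d : R, 0 < d &
    forall y, D y -> ball (F y) d `<=` F @` (D `&` ball y e).

(* Main.v *)
Require Import Defs.
From mathcomp Require Import all_boot all_order all_algebra.
From mathcomp Require Import all_classical all_reals all_analysis.
From mathcomp Require Import ring lra.
Import Order.TTheory GRing.Theory Num.Theory.
Import numFieldNormedType.Exports.
Local Open Scope classical_set_scope.
Local Open Scope ring_scope.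

(** Write a point of the ball around [xy] as [xy + h] with [|h|_1 < e^2/16].
    Coordinate by coordinate, [xy + h] can be refactored as [uv] at any scale
    [c > 0]: at the cost of moving [y] by at most [2c] one needs to move [x]
    only by [3|h|/c] ([perturb_factors]).  A constant scale would already give
    the analogous result with all of [ell_inf] as second factor, but then
    [v - y] need not tend to 0.  So the scale must itself be a null sequence
    [c_n], while [sum |h_n|/c_n] must stay small.  This is possible because no
    convergent series is the slowest one to converge: if [r_n > 0] are the
    tails of [sum |h_n|], then [sum |h_n| / sqrt r_n] still converges, with
    sum at most [2 sqrt r_0], by comparison with the telescoping series of
    [2 (sqrt r_n - sqrt r_(n+1))].  The lemma [null_scale] records this with
    [p_n = sqrt r_n], for slightly enlarged tails; its bound on [p_0] is used
    as [p_0 < e/4].  With [c_n = 2 p_n] the two errors are at most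
    [3 p_0 < e] in [ell_1] and [4 p_0 < e] in [ell_inf], and
    [|v_n - y_n| <= 4 p_n] tends to 0.

    Uniform openness is the same inclusion with [delta = e^2/16], balls of the
    product space being products of balls. *)

(** If [y] is not small, the error [h] is absorbed by [x]; if [x] is large
    compared with [h/c], it is absorbed by [y]; otherwise both [x] and [y] are
    small, so that replacing [y] by [c], and [x] by the quotient which this
    imposes, moves neither of them far. *)
Lemma perturb_factors (R : realFieldType) (x y h c : R) : 0 < c ->
  exists uv : R * R, [/\ uv.1 * uv.2 = x * y + h,
    `|uv.1 - x| <= 3 * `|h| / c & `|uv.2 - y| <= 2 * c].
Proof.
move=> c0; have h0 := normr_ge0 h.
have [cy|yc] := leP c `|y|.
  have y0 : y != 0 by rewrite -normr_gt0 (lt_le_trans c0).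
  exists (x + h / y, y) => /=; split; first by field.
    rewrite (addrC x) addrK normrM normfV ler_pM ?invr_ge0//; first by lra.
    by rewrite lef_pV2 ?posrE ?normr_gt0.
  by rewrite subrr normr0; lra.
have [hx|xh] := ltP `|h| (`|x| * c).
  have x0 : x != 0.
    by apply/eqP => x0; move: hx; rewrite x0 normr0 mul0r ltNge h0.
  exists (x, y + h / x) => /=; split; first by field.
    by rewrite subrr normr0 divr_ge0 ?mulr_ge0 ?(ltW c0).
  rewrite (addrC y) addrK normrM normfV ler_pdivrMr ?normr_gt0//.
  have := normr_ge0 x; nra.
exists ((x * y + h) / c, c) => /=; split; first by rewrite divfK ?gt_eqF.
  have -> : (x * y + h) / c - x = (h + x * (y - c)) / c.
    by field; rewrite gt_eqF.
  rewrite normrM normfV (gtr0_norm c0) ler_pM2r ?invr_gt0//.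
  rewrite (le_trans (ler_normD _ _))// normrM.
  have : `|y - c| <= 2 * c by move: yc; rewrite ltr_norml ler_norml; lra.
  move/(ler_wpM2l (normr_ge0 x)); nra.
by move: yc; rewrite ltr_norml ler_norml; lra.
Qed.

(** The sequence [p] is the square root of the tails of [sum |h_n|].  A null
    term [eta / (n+1)] is added to the tails, which keeps them positive even
    when [h] is finitely supported; the strict inequality on the norm of [h]
    leaves room for it. *)
Lemma null_scale (R : realType) (h : ell1 R) (s : R) :
  0 < s -> ell1_norm h < s ^+ 2 ->
  exists p : R^nat, [/\ forall n, 0 < p n, p 0%N < s, nonincreasing_seq p,
    p @ \oo --> (0 : R) &
    forall n, `|h n| / (2 * p n) <= p n - p n.+1].
Proof.
move=> s0 hs; pose S : R^nat := [normed series h].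
have SS n : S n.+1 = S n + `|h n| by rewrite /S /= /series /= big_nat_recr.
have Sle n : S n <= ell1_norm h.
  have nd : nondecreasing_seq S.
    by apply: nondecreasing_series => i _ _; exact: normr_ge0.
  exact: nondecreasing_cvgn_le nd (@ell1P R h) n.
pose eta := (s ^+ 2 - ell1_norm h) / 2.
have eta0 : 0 < eta by rewrite divr_gt0 ?subr_gt0.
pose r : R^nat := fun n => ell1_norm h - S n + eta * harmonic n.
have r0 n : 0 < r n.
  by rewrite ltr_wpDl ?subr_ge0 ?Sle// mulr_gt0 ?harmonic_gt0.
have rS n : `|h n| <= r n - r n.+1.
  have : harmonic n.+1 <= harmonic n :> R.
    by rewrite /harmonic /= lef_pV2 ?posrE ?ltr0n// ler_nat.
  move/(ler_wpM2l (ltW eta0)).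
  rewrite /r SS; lra.
have rr n : r n.+1 <= r n by have := rS n; have := normr_ge0 (h n); lra.
exists (Num.sqrt \o r); split => /=.
- by move=> n; rewrite sqrtr_gt0.
- rewrite -[ltRHS]gtr0_norm// -sqrtr_sqr ltr_sqrt ?exprn_gt0//.
  by rewrite /r /S /= /series /= big_geq// /harmonic /= invr1 /eta; lra.
- by apply/nonincreasing_seqP => n /=; rewrite ler_wsqrtr.
- rewrite -[X in _ --> X]sqrtr0; apply: continuous_cvg.
    exact: sqrt_continuous.
  have -> : (0 : R) = ell1_norm h - ell1_norm h + eta * 0.
    by rewrite subrr mulr0 addr0.
  apply: cvgD; first by apply: cvgB; [exact: cvg_cst | exact: ell1P].
  by apply: cvgMr; exact: cvg_harmonic.
- move=> n; rewrite ler_pdivrMr ?mulr_gt0 ?sqrtr_gt0//.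
  have := rS n; rewrite -{1}(sqr_sqrtr (ltW (r0 n))).
  rewrite -{1}(sqr_sqrtr (ltW (r0 n.+1))).
  (* p_n^2 - p_(n+1)^2 <= 2 p_n (p_n - p_(n+1)), the difference being the
     square of p_n - p_(n+1) *)
  have := sqr_ge0 (Num.sqrt (r n) - Num.sqrt (r n.+1)); lra.
Qed.

(** Comparison with the telescoping series [sum (d_n - d_(n+1))]. *)
Lemma ell1_telescope (R : realType) (a d : R^nat) : (forall n, 0 <= d n) ->
  (forall n, `|a n| <= d n - d n.+1) ->
  exists2 u : ell1 R, u = a :> R^nat & ell1_norm u <= d 0%N.
Proof.
move=> d0 ad.
have ub n : [normed series a] n <= d 0%N.
  apply: (@le_trans _ _ (d 0%N - d n)); last by rewrite gerBl.
  rewrite -opprB -telescope_sumr// -sumrN /= /series /=.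
  by apply: ler_sum => i _; rewrite opprB.
have ca : cvgn [normed series a].
  apply: nondecreasing_is_cvgn; last by exists (d 0%N) => _ [n _ <-].
  by apply: nondecreasing_series => i _ _; exact: normr_ge0.
have aP : a \in @ell1_pred R by exact/ell1_predP.
by exists (Ell1 aP) => //; apply: limr_le => //; exact: nearW.
Qed.

Lemma ball_ell1_mul (R : realType) (e : R) (x : ell1 R) (y : ellinf R) :
  0 < e -> c0 R y ->
  ball (ell1_mul x y) (e ^+ 2 / 16) `<=`
  [set ell1_mul u v | u in ball x e & v in ball y e `&` c0 R].
Proof.
move=> e0 y0 z; rewrite -ball_normE /= distrC => zxy.
pose h : ell1 R := z - ell1_mul x y.
have hz n : x n * y n + h n = z n by rewrite /h /= addrC subrK.
have [p [p0 ps pd pc ph]] : exists p : R^nat, [/\ forall n, 0 < p n,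
    p 0%N < e / 4, nonincreasing_seq p, p @ \oo --> (0 : R) &
    forall n, `|h n| / (2 * p n) <= p n - p n.+1].
  apply: null_scale; first by rewrite divr_gt0.
  have -> : (e / 4) ^+ 2 = e ^+ 2 / 16 by field.
  exact: zxy.
have pp0 n : 0 <= p n by exact: ltW.
have c_gt0 n : 0 < 2 * p n by rewrite mulr_gt0.
have [w wP] :=
  choice (fun n => perturb_factors _ (x n) (y n) (h n) _ (c_gt0 n)).
have [a aE an] : exists2 a : ell1 R,
    a = (fun n => (w n).1 - x n) :> R^nat & ell1_norm a <= 3 * p 0%N.
  apply: (@ell1_telescope _ _ (fun n => 3 * p n)) => [n|n].
    by rewrite mulr_ge0.
  have [_ + _] := wP n; move/le_trans; apply.
  by rewrite -mulrA -mulrBr ler_pM2l.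
pose b0 : R^nat := fun n => (w n).2 - y n.
have b0p n : `|b0 n| <= 4 * p n.
  have [_ _] := wP n; rewrite /b0; lra.
have b0c : b0 @ \oo --> (0 : R).
  apply/norm_cvg0P; apply: (@squeeze_cvgr _ _ _ _ (cst 0) (fun n => 4 * p n)).
  - by apply: nearW => n /=; rewrite normr_ge0 b0p.
  - exact: cvg_cst.
  - by rewrite -(mulr0 4); apply: cvgMr.
pose b : ellinf R := Ellinf (cvg0_ellinf b0c).
exists (x + a).
  rewrite /= opprD addrA subrr sub0r normrN.
  by apply: (le_lt_trans an); lra.
exists (y + b).
  split.
    rewrite -ball_normE /= opprD addrA subrr sub0r normrN.
    apply: (@le_lt_trans _ _ (4 * p 0%N)); last by lra.
    apply: ellinf_norm_le => n; apply: (le_trans (b0p n)).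
    by rewrite ler_pM2l//; exact: pd.
  by rewrite /c0 /= -(addr0 0); apply: cvgD.
apply/val_inj/funext => n /=.
rewrite aE /b0 /= !(addrC _ (_ - _)) !subrK -hz.
by have [] := wP n.
Qed.

Theorem theorem7 (R : realType) :
  uniformly_open_on ([set: ell1 R] `*` c0 R)
    (fun p : ell1 R * ellinf R => ell1_mul p.1 p.2) /\
  (forall (e : R) (x : ell1 R) (y : ellinf R), 0 < e -> c0 R y ->
     ball (ell1_mul x y) (e ^+ 2 / 16) `<=`
     [set ell1_mul u v | u in ball x e & v in ball y e `&` c0 R]).
Proof.
split; last exact: ball_ell1_mul.
move=> e e0; exists (e ^+ 2 / 16); first by rewrite divr_gt0 ?exprn_gt0.
move=> [x y] [_ y0] z /(@ball_ell1_mul _ _ _ _ e0 y0)[u xu [v [yv v0] <-]].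
by exists (u, v).
Qed.
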